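(* Let $(E_n)_{n\in\mathbb{N}}$ be a betting sequence with drift certificate $(c_n)$, let $t\in\mathbb{N}$ and $\alpha\in(0,1)$, and let $C_t\in\mathbb{R}$ be a constant with $\sum_{n\le t}c_n\ge C_t$ $\mathbb{P}_1$-a.s. Assume there are constants $b_n\in(0,\infty)$ and $w_n\in[0,\infty)$ such that, $\mathbb{P}_1$-a.s. for every $n\in\mathbb{N}$, $$E_n\ge e^{c_n-b_n}\quad(\text{equivalently }L_n\ge c_n-b_n),\qquad \mathbb{E}_{\mathbb{P}_1}[(L_n-c_n)^2\mid\mathcal{F}_{n-1}]\le w_n .$$ Let $w\ge\sum_{n\le t}w_n$ and $b\ge\max_{n\le t}b_n$ be constants. Then, with $s_{\max}=\infty$, $$\psi_n(s):=\frac{w_n}{b_n^2}\big(e^{sb_n}-sb_n-1\big)$$ is a majorant, with aggregate $\Psi^{(t)}(s)=\frac{w}{b^2}(e^{sb}-sb-1)$; the rate function is $$(\Psi^{(t)})^{\star}(x)=\frac{w}{b^2}\,h\Big(\frac{bx}{w}\Big)\ \ge\ \frac{x^2}{2\big(w+\frac{bx}{3}\big)},\qquad h(z):=(1+z)\log(1+z)-z ;$$ the optimising tilt is $$s_t^{\ast}=\frac1b\log\Big(1+\frac{b\Delta_t}{w}\Big);$$ and $$\bar\gamma_t(\alpha)\le\gamma_t(\alpha)\le\exp\Big(-\frac{w}{b^2}h\Big(\frac{b\Delta_t}{w}\Big)\Big)\le\exp\Big(-\frac{\Delta_t^2}{2\big(w+\frac{b\Delta_t}{3}\big)}\Big).$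$
   Context: Conventions: $\log$ is natural, $\log0=-\infty$; $(x)_+=\max\{x,0\}$. Setting: $(\Omega,\mathcal{F})$ is a measurable space with a filtration $(\mathcal{F}_t)_{t\in\mathbb{N}_0}$, $\mathcal{F}_0=\{\emptyset,\Omega\}$, and $\mathbb{P}_0,\mathbb{P}_1$ are probability measures with $\mathbb{P}_1|_{\mathcal{F}_t}\ll\mathbb{P}_0|_{\mathcal{F}_t}$ for all $t$. A betting sequence is a family of $\mathcal{F}_n$-measurable maps $E_n:\Omega\to[0,\infty]$ with $\mathbb{E}_{\mathbb{P}_0}[E_n\mid\mathcal{F}_{n-1}]\le1$ $\mathbb{P}_0$-a.s. Wealth: $W_0=1$, $W_t=\prod_{n\le t}E_n$; $L_n:=\log E_n$. For $\alpha\in(0,1)$: $\ell:=\log\frac1\alpha$, $\tau_\alpha:=\inf\{t\in\mathbb{N}:W_t>\frac1\alpha\}$, $\gamma_t(\alpha):=\mathbb{P}_1(W_t\le\frac1\alpha)$, $\bar\gamma_t(\alpha):=\mathbb{P}_1(\tau_\alpha>t)$; $\Delta_t:=(C_t-\ell)_+$. Drift certificate: real random variables $c_n$, $\mathcal{F}_{n-1}$-measurable, with $\mathbb{E}_{\mathbb{P}_1}[L_n\mid\mathcal{F}_{n-1}]\ge c_n$ $\mathbb{P}_1$-a.s. Put $\varphi_n(s):=\log\mathbb{E}_{\mathbb{P}_1}[e^{-s(L_n-c_n)}\mid\mathcal{F}_{n-1}]$. Majorant on $[0,s_{\max})$: maps $\psi_n:[0,s_{\max})\times\Omega\to[0,\infty]$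 with $\psi_n(s)$ $\mathcal{F}_{n-1}$-measurable, $\psi_n(0)=0$, and $\varphi_n(s)\le\psi_n(s)$ $\mathbb{P}_1$-a.s. for all $n$, $s$. Aggregate (at horizon $t$): deterministic $C_t$, $\Psi^{(t)}$ with $\sum_{n\le t}c_n\ge C_t$ and $\sum_{n\le t}\psi_n(s)\le\Psi^{(t)}(s)$ $\mathbb{P}_1$-a.s. for all $s\in[0,s_{\max})$. Rate function: $(\Psi^{(t)})^{\star}(x):=\sup_{s\in[0,s_{\max})}\{sx-\Psi^{(t)}(s)\}$, $x\ge0$; the optimising tilt is a maximiser of this supremum at $x=\Delta_t$. *)

(* Defs.v *)
From mathcomp Require Import all_boot all_order all_algebra.
From mathcomp Require Import all_classical all_reals all_analysis.
From mathcomp Require Import measurable_realfun.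
Set Implicit Arguments.
Unset Strict Implicit.
Unset Printing Implicit Defensive.
Import Order.TTheory GRing.Theory Num.Theory.
Import numFieldNormedType.Exports.
Local Open Scope classical_set_scope.
Local Open Scope ring_scope.
Local Open Scope ereal_scope.

(* Random variables, filtrations and constants are indexed by [nat]; index [0]
   is used only for the filtration, since betting rounds are numbered
   from 1. *)

Section Filtration.
Context (d : measure_display) (T : measurableType d) (R : realType).

Record is_filtration (F : nat -> set (set T)) : Prop := IsFiltration {
  filtration_sigma : forall t, sigma_algebra setT (F t) ;
  filtration_sub : forall t, F t `<=` measurable ;
  filtration_mono : forall s t, (s <= t)%N -> F s `<=` F t ;
  filtration_0 : F 0%N = [set set0; setT] }.

(* [G] is meant to be a sigma-algebra, so that it is the family of measurable
   sets of [g_sigma_algebraType G]. *)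
Definition measurable_wrt (G : set (set T)) d' (U : measurableType d')
    (X : T -> U) :=
  measurable_fun (setT : set (g_sigma_algebraType G)) X.

Definition loc_dominated (F : nat -> set (set T)) (P1 P0 : probability T R) :=
  forall t A, F t A -> P0 A = 0 -> P1 A = 0.

(* [Y] is a version of E_P[X | G], for X with values in [0, +oo].
   Versions are a.s. unique, so an a.s. bound on E_P[X | G] is stated below as
   the existence of a version satisfying it. *)
Definition cond_exp_ge0 (P : probability T R) (G : set (set T))
    (X Y : T -> \bar R) : Prop :=
  [/\ forall x, 0 <= Y x, measurable_wrt G Y &
      forall A, G A -> \int[P]_(x in A) Y x = \int[P]_(x in A) X x].

(* [Y] is a version of E_P[X | G] := E_P[X^+ | G] - E_P[X^- | G]; the
   conditional expectation exists when the difference is a.s. not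
   [+oo - +oo], which does not require X to be integrable. *)
Definition cond_exp (P : probability T R) (G : set (set T))
    (X Y : T -> \bar R) : Prop :=
  measurable_wrt G Y /\
  exists Yp Yn : T -> \bar R,
    [/\ cond_exp_ge0 P G X^\+ Yp, cond_exp_ge0 P G X^\- Yn &
        {ae P, forall x, (Yp x < +oo \/ Yn x < +oo) /\ Y x = Yp x - Yn x}].

End Filtration.

Section Betting.
Context (d : measure_display) (T : measurableType d) (R : realType).
Variables (F : nat -> set (set T)) (P0 P1 : probability T R).

Definition betting_sequence (E : nat -> T -> \bar R) : Prop :=
  forall n, (0 < n)%N ->
    [/\ forall x, 0 <= E n x, measurable_wrt (F n) (E n) &
        exists2 Y, cond_exp_ge0 P0 (F n.-1) (E n) Y &
                   {ae P0, forall x, Y x <= 1}].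

Definition wealth (E : nat -> T -> \bar R) (t : nat) (x : T) : \bar R :=
  \prod_(1 <= n < t.+1) E n x.

Definition log_bet (E : nat -> T -> \bar R) (n : nat) (x : T) : \bar R :=
  lne (E n x).

(* First passage time, with value [+oo] when the level is never exceeded. *)
Definition tau (E : nat -> T -> \bar R) (alpha : R) (x : T) : \bar R :=
  ereal_inf [set (k%:R : R)%:E | k in
    [set k : nat | (0 < k)%N /\ (alpha^-1)%:E < wealth E k x]].

Definition gamma (E : nat -> T -> \bar R) (t : nat) (alpha : R) : \bar R :=
  P1 [set x | wealth E t x <= (alpha^-1)%:E].

Definition gamma_bar (E : nat -> T -> \bar R) (t : nat) (alpha : R) : \bar R :=
  P1 [set x | (t%:R : R)%:E < tau E alpha x].

Definition excess_drift (C alpha : R) : R := Num.max (C - ln alpha^-1)%R 0%R.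

Definition drift_certificate (E : nat -> T -> \bar R) (c : nat -> T -> R)
    : Prop :=
  forall n, (0 < n)%N ->
    measurable_wrt (F n.-1) (c n) /\
    exists2 Y, cond_exp P1 (F n.-1) (log_bet E n) Y &
               {ae P1, forall x, (c n x)%:E <= Y x}.

Definition centred (E : nat -> T -> \bar R) (c : nat -> T -> R)
    (n : nat) (x : T) : \bar R :=
  log_bet E n x - (c n x)%:E.

(* [Phi] is a version of log E_P1[exp(- s (L_n - c_n)) | F_(n-1)]. *)
Definition cond_cgf (E : nat -> T -> \bar R) (c : nat -> T -> R)
    (n : nat) (s : R) (Phi : T -> \bar R) : Prop :=
  exists2 Y,
    cond_exp_ge0 P1 (F n.-1) (fun x => expeR (- (s%:E * centred E c n x))) Y &
    Phi = (fun x => lne (Y x)).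

Definition tilts (smax : \bar R) : set R :=
  [set s | (0 <= s)%R /\ s%:E < smax].

Record is_majorant (E : nat -> T -> \bar R) (c : nat -> T -> R)
    (smax : \bar R) (psi : nat -> R -> T -> \bar R) : Prop := IsMajorant {
  majorant_ge0 : forall n s x, (0 < n)%N -> tilts smax s -> 0 <= psi n s x ;
  majorant_meas : forall n s, (0 < n)%N -> tilts smax s ->
    measurable_wrt (F n.-1) (psi n s) ;
  majorant_0 : forall n x, (0 < n)%N -> psi n 0%R x = 0 ;
  majorant_le : forall n s, (0 < n)%N -> tilts smax s ->
    exists2 Phi, cond_cgf E c n s Phi &
                 {ae P1, forall x, Phi x <= psi n s x} }.

Record is_aggregate (c : nat -> T -> R) (smax : \bar R)
    (psi : nat -> R -> T -> \bar R) (t : nat) (C : R) (Psi : R -> \bar R)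
    : Prop := IsAggregate {
  aggregate_drift :
    {ae P1, forall x, (C <= \sum_(1 <= n < t.+1) c n x)%R} ;
  aggregate_cgf : forall s, tilts smax s ->
    {ae P1, forall x, \sum_(1 <= n < t.+1) psi n s x <= Psi s} }.

End Betting.

Section Rate.
Context (R : realType).

Definition rate_function (smax : \bar R) (Psi : R -> \bar R) (x : R) : \bar R :=
  ereal_sup [set (s * x)%:E - Psi s | s in tilts smax].

Definition is_optimal_tilt (smax : \bar R) (Psi : R -> \bar R) (x s : R)
    : Prop :=
  tilts smax s /\ (s * x)%:E - Psi s = rate_function smax Psi x.

Definition bennett_cgf (w b s : R) : R :=
  (w / b ^+ 2 * (expR (s * b) - s * b - 1))%R.

Definition bennett_h (z : R) : R := ((1 + z) * ln (1 + z) - z)%R.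

(* (w / b^2) h(b x / w) for x >= 0 and b > 0.  Where w = 0 makes the quotient
   meaningless, the value is the limit as w decreases to 0. *)
Definition bennett_rate (w b x : R) : \bar R :=
  if w == 0%R then (if x == 0%R then 0 else +oo)
  else (w / b ^+ 2 * bennett_h (b * x / w))%:E.

(* For w = x = 0 the quotient is 0 / 0 = 0, again the limit as w decreases
   to 0. *)
Definition bernstein_rate (w b x : R) : R :=
  (x ^+ 2 / (2 * (w + b * x / 3)))%R.

End Rate.

(* Main.v *)
Require Import Defs.
From HB Require Import structures.
From mathcomp Require Import all_boot all_order all_algebra.
From mathcomp Require Import all_classical all_reals all_analysis.
From mathcomp Require Import measurable_realfun ring lra.
Set Implicit Arguments.
Unset Strict Implicit.
Unset Printing Implicit Defensive.
Import Order.TTheory GRing.Theory Num.Theory.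
Import numFieldNormedType.Exports.
Local Open Scope classical_set_scope.
Local Open Scope ring_scope.
Local Open Scope ereal_scope.

(* Put U_n = L_n - c_n.  Since U_n >= -b_n and (e^y - 1 - y) / y^2 is
   nondecreasing in y, e^{-sU} <= 1 - sU + U^2 (e^{sb} - 1 - sb) / b^2; the
   drift certificate makes the conditional expectation of the linear term
   nonpositive, which gives the majorant.  Conditioning round by round,
   E exp(-s sum_{n <= t} U_n) <= exp(Psi(s)), and Markov's inequality bounds
   gamma by exp(-(s Delta - Psi(s))) for every s >= 0; the supremum over s is
   the Bennett rate. *)

(** * The Bennett and Bernstein rates *)

Section RealInequalities.
Context (R : realType).
Local Open Scope ring_scope.
Implicit Types b r s u w x y z : R.

(** The obstacle is integrability: [L_n] is extended-real-valued and [c_n] need not be bounded, so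
    [L_n - c_n] cannot be conditioned term by term. Conditional bounds are therefore read as bounds
    on integrals over sets of the sigma-algebra, and in each inequality positive and negative parts
    are moved to opposite sides, so that all integrands are nonnegative and only integrals known to
    be finite are cancelled. The second-moment bound supplies this finiteness: it makes [U_n]
    integrable, hence a.s. finite. As [U_n] has no upper bound, the exponential inequality must hold
    for arbitrarily negative exponents [- s U_n], which is why the scaling ratio in
    [expR_rem2_scale] is bounded from above only. The tail bound passes through the supremum itself
    and not through a chosen tilt, because for [w = 0] the supremum may be infinite and attained
    nowhere. *)

Lemma ge0_is_derive_ndecr (f df : R -> R) :
  (forall x, 0 <= x -> is_derive x 1 f (df x)) ->
  (forall x, 0 <= x -> 0 <= df x) ->
  forall x, 0 <= x -> f 0 <= f x.
Proof.
move=> fdf df0 x x0.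
apply: (@ger0_derive1_ndecry _ f 0) => //.
- move=> y; rewrite in_itv/= andbT => /ltW y0.
  by case: (fdf _ y0).
- move=> y; rewrite in_itv/= andbT => /ltW y0.
  by rewrite derive1E; have := fdf _ y0 => fy; rewrite derive_val df0.
- apply: derivable_within_continuous => y; rewrite in_itv/= andbT => y0.
  by case: (fdf _ y0).
Qed.

(* In [z], the derivative of the difference of the two sides is
   r (r (e^z - 1) - (e^{rz} - 1)); both factors have the sign of [r]. *)
Lemma expR_rem2_scale r z : r <= 1 -> 0 <= z ->
  expR (r * z) - 1 - r * z <= r ^+ 2 * (expR z - 1 - z).
Proof.
move=> r1 z0; rewrite -subr_ge0.
pose H x := r ^+ 2 * (expR x - 1 - x) - (expR (r * x) - 1 - r * x).
have <- : H 0 = 0 by rewrite /H mulr0 expR0; ring.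
apply: (@ge0_is_derive_ndecr H
  (fun x => r * (r * (expR x - 1) - (expR (r * x) - 1)))) => // x x0.
  rewrite /H; apply: is_derive_eq.
  rewrite /GRing.scale/=; ring.
have e1 := expR_ge1Dx x.
have e2 := expR_ge1Dx (r * x).
have [r0|r0] := leP r 0.
  by apply: mulr_le0 => //; nra.
apply: mulr_ge0; first exact: ltW.
(* Convexity of exp by hand: [e3] and [e4] say that exp lies above its tangent at [r * x], at the
   points [x] and [0]. Weighted by [r] and [1 - r], the linear terms cancel. *)
have e3 : expR x >= expR (r * x) * (1 + (1 - r) * x).
  have -> : expR x = expR (r * x) * expR ((1 - r) * x).
    by rewrite -expRD; congr expR; ring.
  by apply: ler_wpM2l; [exact: expR_ge0|exact: expR_ge1Dx].
have e4 : 1 >= expR (r * x) * (1 - r * x).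
  rewrite [leRHS](_ : 1 = expR (r * x) * expR (- (r * x))).
    by apply: ler_wpM2l; [exact: expR_ge0|exact: expR_ge1Dx].
  by rewrite -expRD subrr expR0.
have e0 := expR_ge0 (r * x).
have f1 : 0 <= r * (expR x - expR (r * x) * (1 + (1 - r) * x)).
  by rewrite mulr_ge0// ?subr_ge0// ltW.
have f2 : 0 <= (1 - r) * (1 - expR (r * x) * (1 - r * x)).
  by rewrite mulr_ge0// ?subr_ge0.
have -> : r * (expR x - 1) - (expR (r * x) - 1) =
  r * (expR x - expR (r * x) * (1 + (1 - r) * x)) +
  (1 - r) * (1 - expR (r * x) * (1 - r * x)) by ring.
exact: addr_ge0.
Qed.

Lemma expR_rem2_ge0 y : 0 <= expR y - y - 1.
Proof. by have := expR_ge1Dx y; lra. Qed.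

Lemma bennett_cgf_ge0 w b s : 0 <= w -> 0 <= bennett_cgf w b s.
Proof.
by move=> w0; rewrite mulr_ge0 ?expR_rem2_ge0// divr_ge0// sqr_ge0.
Qed.

Lemma bennett_cgf_tilt0 w b : bennett_cgf w b 0 = 0.
Proof. by rewrite /bennett_cgf mul0r expR0 subr0 subrr mulr0. Qed.

(** Monotonicity in the range parameter is [expR_rem2_scale] with ratio [b / c]; it allows the
    ranges of the single rounds to be replaced by a common one. *)
Lemma bennett_cgf_le w b v c s :
  0 <= s -> 0 < b -> b <= c -> 0 <= w -> w <= v ->
  bennett_cgf w b s <= bennett_cgf v c s.
Proof.
move=> s0 b0 bc w0 wv; have c0 := lt_le_trans b0 bc.
apply: (@le_trans _ _ (w / c ^+ 2 * (expR (s * c) - s * c - 1))); last first.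
  by rewrite ler_wpM2r ?expR_rem2_ge0// ler_wpM2r// invr_ge0 sqr_ge0.
rewrite /bennett_cgf -!mulrA ler_wpM2l//.
rewrite mulrC ler_pdivrMr ?exprn_gt0//.
have := @expR_rem2_scale (b / c) (s * c).
rewrite ler_pdivrMr// mul1r bc => /(_ isT (mulr_ge0 s0 (ltW c0))).
have -> : b / c * (s * c) = s * b by field; rewrite gt_eqF.
move=> h; rewrite (_ : _ - s * b - 1 = expR (s * b) - 1 - s * b); last by ring.
apply: (le_trans h); rewrite le_eqVlt; apply/orP; left; apply/eqP.
by field; rewrite gt_eqF.
Qed.

(** This is [expR_rem2_scale] with ratio [- u / b] and [z = s * b]: the lower bound on [u] is
    exactly the condition that the ratio is at most 1. *)
Lemma expRN_le_bennett s b u : 0 <= s -> 0 < b -> - b <= u ->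
  expR (- (s * u)) <= 1 - s * u + bennett_cgf 1 b s * u ^+ 2.
Proof.
move=> s0 b0 bu.
have := @expR_rem2_scale (- u / b) (s * b).
rewrite ler_pdivrMr// mul1r lerNl bu => /(_ isT (mulr_ge0 s0 (ltW b0))).
have -> : - u / b * (s * b) = - (s * u) by field; rewrite gt_eqF.
rewrite (_ : (- u / b) ^+ 2 * _ = bennett_cgf 1 b s * u ^+ 2); first by lra.
by rewrite /bennett_cgf; field; rewrite gt_eqF.
Qed.

Lemma bennett_h_ge z : 0 <= z -> z ^+ 2 / (2 * (1 + z / 3)) <= bennett_h z.
Proof.
move=> z0.
(* [f] is the difference of the two sides divided by [1 + x]. The division frees the logarithm of
   its factor, so the derivative is rational, and it simplifies to a visibly nonnegative
   quotient. *)
pose f x := ln (1 + x) - (6 * x + 5 * x ^+ 2) / ((1 + x) * (6 + 2 * x)).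
have f0 : f 0 = 0 by rewrite /f addr0 ln1 expr2 !mulr0 addr0 mul0r subr0.
have fz : 0 <= f z.
  rewrite -f0; apply: (@ge0_is_derive_ndecr f
    (fun x => x ^+ 3 / ((1 + x) ^+ 2 * (3 + x) ^+ 2))) => // x x0; last first.
    by rewrite divr_ge0// ?mulr_ge0// ?exprn_ge0//; lra.
  have x1 : 0 < 1 + x by lra.
  have x2 : (1 + x) * (6 + 2 * x) != 0 by rewrite gt_eqF// mulr_gt0//; lra.
  have d1 : is_derive x 1 (fun x => ln (1 + x)) (1 + x)^-1.
    have h1 := is_derive1_ln x1.
    have h2 : is_derive x 1 (fun x => 1 + x) 1.
      by apply: is_derive_eq; rewrite add0r mulr1.
    have := @is_derive1_comp _ (@ln R) (fun x => 1 + x) _ _ _ h1 h2.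
    by rewrite mulr1.
  have d2 : is_derive x 1 (fun x => (1 + x) * (6 + 2 * x))
      ((1 + x) * 2 + (6 + 2 * x)).
    by apply: is_derive_eq; rewrite /GRing.scale/=; ring.
  have d3 := @is_deriveV _ (fun x => (1 + x) * (6 + 2 * x)) _ _ _ x2 d2.
  have d4 : is_derive x 1 (fun x => 6 * x + 5 * x ^+ 2) (6 + 10 * x).
    by apply: is_derive_eq; rewrite /GRing.scale/=; ring.
  have d5 := is_deriveM d4 d3.
  have := is_deriveB d1 d5.
  rewrite /GRing.scale/= => d6.
  apply: (is_derive_eq d6); field.
  by rewrite !gt_eqF//; lra.
have z1 : 0 < 1 + z by lra.
rewrite /bennett_h -subr_ge0.
have -> : (1 + z) * ln (1 + z) - z - z ^+ 2 / (2 * (1 + z / 3)) = (1 + z) * f z.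
  by rewrite /f; field; rewrite !gt_eqF//; lra.
by rewrite mulr_ge0// ltW.
Qed.

(** Fenchel-Young inequality: [bennett_h] is the convex conjugate of [e^y - y - 1]. It is the
    tangent inequality of exp at [ln (1 + z)], with equality at [y = ln (1 + z)]. *)
Lemma legendre_le z y : 0 <= z -> z * y - (expR y - y - 1) <= bennett_h z.
Proof.
move=> z0; have z1 : 0 < 1 + z by lra.
have := expR_ge1Dx (y - ln (1 + z)).
rewrite -(ler_pM2l z1) expRD expRN lnK ?posrE// mulrCA divff ?gt_eqF// mulr1.
rewrite /bennett_h; nra.
Qed.

Lemma legendre_eq z : 0 <= z ->
  z * ln (1 + z) - (expR (ln (1 + z)) - ln (1 + z) - 1) = bennett_h z.
Proof.
move=> z0; have z1 : 0 < 1 + z by lra.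
by rewrite lnK ?posrE// /bennett_h; ring.
Qed.

(** The substitution [y = s * b], [z = b * x / w] normalises both parameters away. *)
Lemma tilt_bennett_cgfE w b x s : 0 < w -> 0 < b ->
  s * x - bennett_cgf w b s =
  w / b ^+ 2 * (b * x / w * (s * b) - (expR (s * b) - s * b - 1)).
Proof. by move=> w0 b0; rewrite /bennett_cgf; field; rewrite !gt_eqF. Qed.

Lemma tilt_bennett_cgf_le w b x s : 0 < w -> 0 < b -> 0 <= x ->
  s * x - bennett_cgf w b s <= w / b ^+ 2 * bennett_h (b * x / w).
Proof.
move=> w0 b0 x0; rewrite tilt_bennett_cgfE//.
rewrite ler_wpM2l ?legendre_le// divr_ge0 ?sqr_ge0 ?mulr_ge0//; exact: ltW.
Qed.

Lemma tilt_bennett_cgf_opt w b x : 0 < w -> 0 < b -> 0 <= x ->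
  let s := b^-1 * ln (1 + b * x / w) in
  s * x - bennett_cgf w b s = w / b ^+ 2 * bennett_h (b * x / w).
Proof.
move=> w0 b0 x0 s; rewrite tilt_bennett_cgfE//.
have -> : s * b = ln (1 + b * x / w) by rewrite /s; field; rewrite gt_eqF.
by rewrite legendre_eq// divr_ge0 ?mulr_ge0//; exact: ltW.
Qed.

Lemma opt_tilt_ge0 w b x : 0 < w -> 0 < b -> 0 <= x ->
  0 <= b^-1 * ln (1 + b * x / w).
Proof.
move=> w0 b0 x0; rewrite mulr_ge0 ?invr_ge0 ?(ltW b0)// ln_ge0// lerDl.
by rewrite divr_ge0 ?mulr_ge0//; exact: ltW.
Qed.

Lemma rate_function_bennett w b x : 0 <= w -> 0 < b -> 0 <= x ->
  rate_function +oo (fun s => (bennett_cgf w b s)%:E) x = bennett_rate w b x.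
Proof.
move=> w0 b0 x0; rewrite /rate_function /bennett_rate.
have [{w0}->|wn0] := eqVneq w 0.
  have cgf0 s : bennett_cgf 0 b s = 0 by rewrite /bennett_cgf !mul0r.
  have [->|xn0] := eqVneq x 0.
    apply/eqP; rewrite eq_le; apply/andP; split.
      apply: ge_ereal_sup => _ [s _ <-].
      by rewrite cgf0 mulr0 sube0.
    apply: le_ereal_sup_tmp; exists 0%E => //; exists 0.
      by split => //; rewrite ltry.
    by rewrite cgf0 mulr0 sube0.
  have xp : 0 < x by rewrite lt_neqAle eq_sym xn0.
  apply/eqyP => M M0; apply: le_ereal_sup_tmp; exists M%:E => //.
  (* For [w = 0] the objective is [s * x] alone, so this tilt reaches any prescribed level [M]. *)
  exists (M / x).
    by split; [rewrite divr_ge0// ltW|rewrite ltry].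
  by rewrite cgf0 sube0 divfK.
have wp : 0 < w by rewrite lt_neqAle eq_sym wn0.
apply/eqP; rewrite eq_le; apply/andP; split.
  apply: ge_ereal_sup => _ [s _ <-].
  by rewrite -EFinB lee_fin tilt_bennett_cgf_le.
apply: le_ereal_sup_tmp; exists (w / b ^+ 2 * bennett_h (b * x / w))%:E => //.
exists (b^-1 * ln (1 + b * x / w)).
  by split; [exact: opt_tilt_ge0|rewrite ltry].
by rewrite -EFinB tilt_bennett_cgf_opt.
Qed.

Lemma bernstein_le_bennett w b x : 0 <= w -> 0 < b -> 0 <= x ->
  ((bernstein_rate w b x)%:E <= bennett_rate w b x)%E.
Proof.
move=> w0 b0 x0; rewrite /bennett_rate /bernstein_rate.
have [_|wn0] := eqVneq w 0.
  have [->|_] := eqVneq x 0; last by rewrite leey.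
  by rewrite expr2 mulr0 mul0r.
have wp : 0 < w by rewrite lt_neqAle eq_sym wn0.
have z0 : 0 <= b * x / w by rewrite divr_ge0 ?mulr_ge0// ltW.
rewrite lee_fin (_ : _ / _ = w / b ^+ 2 *
  ((b * x / w) ^+ 2 / (2 * (1 + b * x / w / 3)))); last first.
  have h : 0 <= b * x by rewrite mulr_ge0// ltW.
  by field; rewrite !gt_eqF//; lra.
by rewrite ler_wpM2l ?bennett_h_ge// divr_ge0 ?sqr_ge0.
Qed.

End RealInequalities.

(** * Conditioning on a sub-sigma-algebra *)

Lemma measurable_expeR (R : realType) : measurable_fun setT (@expeR R).
Proof.
have -> : @expeR R = fun x => if x == +oo then +oo else
    if x == -oo then 0 else (expR (fine x))%:E.
  by apply/funext => -[].
apply: measurable_fun_ifT => //; first exact: measurable_fun_eqe.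
apply: measurable_fun_ifT => //; first exact: measurable_fun_eqe.
by apply/measurable_EFinP; apply: measurableT_comp.
Qed.

Lemma measurable_lne (R : realType) : measurable_fun setT (@lne R).
Proof.
have -> : @lne R = fun x => if x <= 0 then -oo else
    if x == +oo then +oo else (ln (fine x))%:E.
  by apply/funext => -[r| |] /=; rewrite ?lee_fin ?leNye ?eqxx.
apply: measurable_fun_ifT => //; first exact: measurable_fun_lee.
apply: measurable_fun_ifT => //; first exact: measurable_fun_eqe.
by apply/measurable_EFinP; apply: measurableT_comp.
Qed.

Section SubSigmaAlgebra.
Context (d : measure_display) (T : measurableType d) (R : realType).
Variable G : set (set T).
Hypotheses (G_sigma : sigma_algebra setT G) (sG : G `<=` measurable).

Lemma measurable_subE :
  (measurable : set (set (g_sigma_algebraType G))) = G.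
Proof. exact: measurable_g_measurableTypeE. Qed.

Lemma measurable_sub_id :
  measurable_fun setT (id : T -> g_sigma_algebraType G).
Proof. by move=> _ A; rewrite measurable_subE setTI => /sG. Qed.

Lemma measurable_wrtW d' (U : measurableType d') (X : T -> U) :
  measurable_wrt G X -> measurable_fun setT X.
Proof. by move=> mX; exact: (measurableT_comp mX measurable_sub_id). Qed.

Variables (P : probability T R).

(* The proofs are arguments so that the measure structure on [G] can be inferred
   from the term. *)
Definition sub_density (X : T -> \bar R) (intX : P.-integrable setT X)
    (X0 : forall x, 0 <= X x) (A : set (g_sigma_algebraType G)) : \bar R :=
  \int[P]_(x in A) X x.

Section sub_density.
Variables (X : T -> \bar R) (intX : P.-integrable setT X).
Hypothesis X0 : forall x, 0 <= X x.
Local Notation nu := (sub_density intX X0).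

Let nu0 : nu set0 = 0. Proof. by rewrite /sub_density integral_set0. Qed.

Let nu_ge0 A : 0 <= nu A. Proof. by apply: integral_ge0 => x _. Qed.

Let nu_sigma : semi_sigma_additive nu.
Proof.
move=> B mB tB mUB.
apply: (semi_sigma_additive_nng_induced (measurable_int P intX) X0) => //.
  by move=> i; have := mB i; rewrite measurable_subE => /sG.
by move: mUB; rewrite measurable_subE => /sG.
Qed.

HB.instance Definition _ := isMeasure.Build _ _ _ nu nu0 nu_ge0 nu_sigma.

Let nu_fin : fin_num_fun nu.
Proof.
move=> A; rewrite measurable_subE => /sG mA.
by apply: integrable_fin_num => //; exact: integrableS intX.
Qed.

HB.instance Definition _ := Measure_isFinite.Build _ _ _ nu nu_fin.

(** Radon-Nikodym on the coarser space: the finite measure [A |-> \int[P]_(x in A) X x] on [G] is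
    dominated by the restriction of [P] to [G], and its density is the version sought. The
    restriction is encoded as the distribution of the identity map into [g_sigma_algebraType G]. *)
Lemma cond_exp_ge0_exists : exists Y, cond_exp_ge0 P G X Y.
Proof.
pose idG : {mfun T >-> g_sigma_algebraType G} :=
  HB.pack (id : T -> g_sigma_algebraType G)
    (isMeasurableFun.Build _ _ _ _ _ measurable_sub_id).
pose Q := distribution P idG.
have nuQ : nu `<< Q.
  apply/null_content_dominatesP => A; rewrite measurable_subE => /sG mA QA.
  apply: null_set_integral => //.
  exact: measurable_funTS (measurable_int P intX).
have [Y [Y0 _ intY YE]] := radon_nikodym_sigma_finite nuQ.
exists Y; split => //; first exact: measurable_int intY.
move=> A GA; have mA : measurable (A : set (g_sigma_algebraType G)).
  by rewrite measurable_subE.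
transitivity (\int[Q]_(x in A) Y x); last by rewrite -YE.
rewrite [RHS]ge0_integral_pushforward//.
apply: measurable_funTS; exact: measurable_int intY.
Qed.

End sub_density.

Import HBNNSimple.

(** Taking out what is known, as an inequality: the hypothesis is the case of indicators of sets of
    [G]; sums of their multiples and monotone convergence give general [M]. *)
Lemma ge0_le_integralM_sub (X : T -> R) (M : T -> \bar R) (K : R) :
  measurable_fun setT X -> (forall x, 0 <= X x)%R -> (0 <= K)%R ->
  (forall A, G A -> \int[P]_(x in A) (X x)%:E <= K%:E * P A) ->
  measurable_wrt G M -> (forall x, 0 <= M x) ->
  \int[P]_x (M x * (X x)%:E) <= K%:E * \int[P]_x M x.
Proof.
move=> mX X0 K0 XK mM M0.
(* The approximation is taken over [g_sigma_algebraType G], so that the level sets of [h n] lie in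
   [G], where [XK] applies. *)
pose h := @nnsfun_approx _ _ _ _ (@measurableT _ (g_sigma_algebraType G)) _ mM.
have mh n : measurable_fun setT (fun x : T => (h n x)%:E).
  apply/measurable_EFinP; apply: measurable_wrtW.
  exact: measurable_funP.
have hM x : (h n x)%:E @[n --> \oo] --> M x.
  exact: (@cvg_nnsfun_approx _ _ _ _ measurableT _ mM).
have ndh x : {homo (fun n => h n x) : m n / (m <= n)%N >-> (m <= n)%R}.
  by move=> m n mn; exact/lefP/nd_nnsfun_approx.
have mXh n : measurable_fun setT (fun x : T => (h n x)%:E * (X x)%:E).
  by apply: emeasurable_funM => //; exact/measurable_EFinP.
have cvgl : \int[P]_x ((h n x)%:E * (X x)%:E) @[n --> \oo] -->
    \int[P]_x (M x * (X x)%:E).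
  rewrite (_ : (fun x => M x * (X x)%:E) =
      fun x => limn (fun n => (h n x)%:E * (X x)%:E)); last first.
    apply/funext => x; apply/esym/cvg_lim => //.
    by apply: cvgeZr => //; exact: hM.
  apply: cvg_monotone_convergence => //.
    by move=> n x _; rewrite mule_ge0 ?lee_fin.
  by move=> x _ m n mn; rewrite lee_wpmul2r ?lee_fin//; exact: ndh.
rewrite -(cvg_lim _ cvgl)//; apply: lime_le.
  by apply/cvg_ex; eexists; exact: cvgl.
apply: nearW => n.
apply: (@le_trans _ _ (K%:E * \int[P]_x (h n x)%:E)); last first.
  rewrite lee_wpmul2l ?lee_fin//; apply: ge0_le_integral => //.
  - by move=> x _; rewrite lee_fin.
  - exact: measurable_wrtW.
  - by move=> x _; rewrite nnsfun_approxE; apply: le_approx.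
pose B y : set T := h n @^-1` [set y].
have GB y : G (B y).
  rewrite -measurable_subE; exact: measurable_sfunP.
have mB y : measurable (B y) by exact: sG.
have hE x : (h n x)%:E = \sum_(y \in range (h n)) (y%:E * (\1_(B y) x)%:E).
  by rewrite fimfunE -fsumEFin.
have phi0 y x : 0 <= y%:E * (\1_(B y) x)%:E by exact: nnfun_muleindic_ge0.
have mphi y : measurable_fun setT (fun x => y%:E * (\1_(B y) x)%:E).
  by apply: emeasurable_funM => //; exact/measurable_EFinP.
under eq_integral do rewrite hE ge0_mule_fsuml//.
under [in leRHS]eq_integral do rewrite hE.
rewrite !ge0_integral_fsum//; last 2 first.
- by move=> y; apply: emeasurable_funM => //; exact/measurable_EFinP.
- by move=> y x _; apply: mule_ge0 => //; rewrite lee_fin.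
rewrite ge0_mule_fsumr; last by move=> y; exact: integral_ge0.
apply: lee_fsum => // y [x _ yE].
have y0 : (0 <= y)%R by rewrite -yE.
have mIB : measurable_fun setT (fun x : T => (\1_(B y) x)%:E : \bar R).
  exact/measurable_EFinP.
rewrite [in leRHS]ge0_integralZl// integral_indic// setIT muleCA.
under eq_integral do rewrite -muleA.
rewrite ge0_integralZl//; last 2 first.
- by apply: emeasurable_funM => //; exact/measurable_EFinP.
- by move=> z _; rewrite mule_ge0 ?lee_fin.
rewrite lee_wpmul2l ?lee_fin//; apply: le_trans (XK _ (GB y)).
rewrite [leRHS]integral_mkcond; apply: ge0_le_integral => //.
- by move=> z _; rewrite mule_ge0 ?lee_fin.
- by apply: emeasurable_funM => //; exact/measurable_EFinP.
- apply/(measurable_restrictT _ _).1 => //.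
  exact/measurable_EFinP/measurable_funTS.
move=> z _; rewrite patchE indicE; case: ifPn => _; first by rewrite mul1e.
by rewrite mul0e.
Qed.

End SubSigmaAlgebra.

(** * The conditional Bennett bound *)

(* [U + c = L], arranged so that only sums of nonnegative terms occur and
   infinite values of [L] are allowed. *)
Lemma funeposneg_subr (T : Type) (R : realType) (L : T -> \bar R) (c : T -> R)
    (U := fun y => L y - (c y)%:E) (e := EFin \o c) (x : T) :
  U^\+ x + (e^\+ x + L^\- x) = U^\- x + (L^\+ x + e^\- x).
Proof.
rewrite !funeposE !funenegE /U /e /=; case: (L x) => [r| |].
- rewrite -EFinB -!EFinN -!EFin_max -!EFinD; congr EFin.
  by rewrite /Num.max; do !case: ifPn; lra.
- by rewrite [- +oo]/= !(maxye, maxNye) -!EFin_max adde0 add0e !addye//.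
- by rewrite [- -oo]/= !(maxye, maxNye) -!EFin_max add0e addey// addye.
Qed.

Section CondExpTools.
Context (d : measure_display) (T : measurableType d) (R : realType).
Variables (P : probability T R).

(** Since [K%:E * P N] is finite it can be subtracted: [Z - K] is positive on [N] but has integral
    at most 0 there. *)
Lemma measure_eq0_of_integral_le (Z : T -> \bar R) (K : R) (N : set T) :
  measurable N -> measurable_fun setT Z -> (0 <= K)%R ->
  (forall x, N x -> K%:E < Z x) ->
  \int[P]_(x in N) Z x <= K%:E * P N -> P N = 0.
Proof.
move=> mN mZ K0 KZ le.
have PN : P N \is a fin_num by exact: fin_num_measure.
have mZK : measurable_fun N (fun x => Z x - K%:E).
  by apply: emeasurable_funB => //; exact: measurable_funTS.
have ZK0 x : N x -> 0 <= Z x - K%:E by move=> /KZ /ltW; rewrite sube_ge0.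
have : \int[P]_(x in N) (Z x - K%:E) = 0.
  apply/eqP; rewrite eq_le integral_ge0// andbT.
  rewrite -(@leeD2rE _ (K%:E * P N)) ?fin_numM// add0e; apply: le_trans le.
  rewrite -(integral_cst _ mN) -ge0_integralD//.
  rewrite le_eqVlt; apply/orP; left; apply/eqP.
  by apply: eq_integral => x _; rewrite subeK.
move=> /eqP; rewrite eq_le => /andP[I0 _].
have : \int[P]_(x in N) `|Z x - K%:E| = 0.
  apply/eqP; rewrite eq_le integral_ge0// andbT (le_trans _ I0)//.
  apply: ge0_le_integral => //; first exact: measurableT_comp.
  by move=> x Nx; rewrite gee0_abs// ZK0.
move/(ae_eq_integral_abs _ mN mZK) => ZK_ae.
apply: measure_negligible => //; apply: negligibleS ZK_ae => x Nx /= /(_ Nx) ZK.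
by have := KZ _ Nx; rewrite -sube_gt0 ZK ltxx.
Qed.


Variable G : set (set T).
Hypotheses (G_sigma : sigma_algebra setT G) (sG : G `<=` measurable).

Lemma cond_exp_ge0_le_integral (X Y : T -> \bar R) (w : R) (A : set T) :
  cond_exp_ge0 P G X Y -> {ae P, forall x, Y x <= w%:E} -> (0 <= w)%R ->
  G A -> \int[P]_(x in A) X x <= w%:E * P A.
Proof.
move=> [Y0 mY YE] Yw w0 GA; have mA := sG GA.
rewrite -YE// -(integral_cst _ mA); apply: ae_ge0_le_integral => //.
- by apply: measurable_funTS; exact: measurable_wrtW mY.
by apply: filterS Yw => x.
Qed.

(* Cutting down to [`|c| <= k] is what lets a bound be tested without assuming
   [c] integrable. *)
Lemma cond_exp_ge0_le (X Y : T -> \bar R) (c : T -> R) (K : R) :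
  measurable_wrt G c -> (0 <= K)%R -> cond_exp_ge0 P G X Y ->
  (forall A k, G A -> (forall x, A x -> `|c x| <= k)%R ->
    \int[P]_(x in A) X x <= K%:E * P A) ->
  {ae P, forall x, Y x <= K%:E}.
Proof.
move=> mc K0 [Y0 mY YE] XK.
pose N k := [set x | K%:E < Y x] `&` [set x | `|c x| <= k%:R]%R.
have GN k : G (N k).
  rewrite -(measurable_subE G_sigma) -[N k]setTI.
  rewrite /N setIA; apply: measurableI.
    exact: (@measurable_lte _ (g_sigma_algebraType G)).
  rewrite -[X in measurable X]setTI.
  apply: (@measurable_fun_le _ (g_sigma_algebraType G)) => //.
  exact: measurableT_comp.
have N0 k : {ae P, forall x, ~ N k x}.
  have : P.-negligible (N k).
    apply/negligibleP; first exact/sG.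
    apply: (@measure_eq0_of_integral_le Y K) => //; first exact/sG.
    - exact: measurable_wrtW mY.
    - by move=> x [].
    by rewrite YE//; apply: (XK _ k%:R) => // x [].
  by apply: negligibleS => x /contrapT.
apply: filterS (ae_foralln N0) => x Nx.
(* The sets [N k] exhaust [K < Y], since [c] is real-valued. *)
rewrite leNgt; apply/negP => KY; apply: (Nx (Num.truncn `|c x|).+1).
by split => //=; rewrite ltW// truncnS_gt.
Qed.

Section Bennett.
Variables (L : T -> \bar R) (c : T -> R) (b w s : R).
Let U x := L x - (c x)%:E.
Let X x := expeR (- (s%:E * U x)).
Hypotheses (mL : measurable_fun setT L) (mc : measurable_wrt G c).
Hypotheses (b0 : (0 < b)%R) (w0 : (0 <= w)%R) (s0 : (0 <= s)%R).
Hypothesis drift : exists2 Y, cond_exp P G L Y &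
  {ae P, forall x, (c x)%:E <= Y x}.
Hypothesis low : {ae P, forall x, (- b)%:E <= U x}.
Hypothesis var : exists2 Y, cond_exp_ge0 P G (fun x => U x ^+ 2) Y &
  {ae P, forall x, Y x <= w%:E}.

Let mc' : measurable_fun setT c. Proof. exact: measurable_wrtW mc. Qed.

Let mU : measurable_fun setT U.
Proof. by apply: emeasurable_funB => //; exact/measurable_EFinP. Qed.

Let mU2 : measurable_fun setT (fun x => U x ^+ 2).
Proof.
by rewrite (_ : (fun _ => _) = U \* U)//; exact: emeasurable_funM.
Qed.

Let U2_ge0 x : 0 <= U x ^+ 2. Proof. exact: sqre_ge0. Qed.

Let mX : measurable_fun setT X.
Proof.
apply: (measurableT_comp (@measurable_expeR R)).
apply: (measurableT_comp (@oppe_measurable R setT)).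
exact: measurable_funeM.
Qed.

Let X_ge0 x : 0 <= X x. Proof. exact: expeR_ge0. Qed.

Let var_le A : G A -> \int[P]_(x in A) (U x ^+ 2) <= w%:E * P A.
Proof. by have [Y YE Yw] := var; exact: cond_exp_ge0_le_integral YE Yw w0. Qed.

(** From [|u| <= 1 + u^2], with the second moment integrated over the whole space. *)
Lemma integrable_of_var : P.-integrable setT U.
Proof.
apply/integrableP; split => //.
have GT : G setT by rewrite -(measurable_subE G_sigma).
apply: (@le_lt_trans _ _ (\int[P]_x (1 + U x ^+ 2))).
  apply: ge0_le_integral => //; first exact: measurableT_comp.
    by apply: emeasurable_funD.
  move=> x _; case: (U x) => [r| |]//.
  rewrite abse_EFin -EFin_expe -EFinD lee_fin.
  have := sqr_ge0 (`|r| - 1)%R; have := sqr_ge0 r.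
  by rewrite -[X in (_ <= 1 + X)%R]real_normK ?num_real//; nra.
rewrite ge0_integralD//.
rewrite integral_cst// mul1e.
apply: lte_add_pinfty; first by rewrite ltey_eq fin_num_measure.
apply: le_lt_trans (var_le GT) _.
by rewrite ltey_eq fin_numM// fin_num_measure.
Qed.


(** The integrated form of E[U | G] >= 0. The drift bound [c <= Yp - Yn] is rearranged into a
    comparison of sums of nonnegative terms and integrated over [A], where [Yp], [Yn] become [L^\+],
    [L^\-]. Combined with [funeposneg_subr], it leaves the claim after cancelling the integral of
    [L^\+ + e^\-], finite because [L^\+ <= U^\+ + e^\+] and [|c| <= k] on [A]. *)
Lemma drift_funeneg_le (A : set T) (k : R) :
  G A -> (forall x, A x -> `|c x| <= k)%R ->
  \int[P]_(x in A) U^\- x <= \int[P]_(x in A) U^\+ x.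
Proof.
move=> GA ck; have mA := sG GA.
have intU := integrableS measurableT mA (@subsetT _ A) integrable_of_var.
have [Y [mY [Yp [Yn [[Yp0 mYp YpE] [Yn0 mYn YnE] YE]]]] cY] := drift.
pose e := EFin \o c.
have me : measurable_fun setT e by exact/measurable_EFinP.
have mep : measurable_fun A e^\+.
  by apply: measurable_funTS; exact: measurable_funepos.
have men : measurable_fun A e^\-.
  by apply: measurable_funTS; exact: measurable_funeneg.
have mLp : measurable_fun A L^\+.
  by apply: measurable_funTS; exact: measurable_funepos.
have mLn : measurable_fun A L^\-.
  by apply: measurable_funTS; exact: measurable_funeneg.
have mUp : measurable_fun A U^\+.
  by apply: measurable_funTS; exact: measurable_funepos.
have mUn : measurable_fun A U^\-.
  by apply: measurable_funTS; exact: measurable_funeneg.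
have bound (f : T -> \bar R) : measurable_fun A f -> (forall x, 0 <= f x) ->
    (forall x, A x -> f x <= k%:E) -> \int[P]_(x in A) f x \is a fin_num.
  move=> mf f0 fk; rewrite ge0_fin_numE ?integral_ge0//.
  apply: (@le_lt_trans _ _ (\int[P]_(x in A) cst k%:E x)).
    by apply: ge0_le_integral.
  by rewrite integral_cst// ltey_eq fin_numM// fin_num_measure.
have fep : \int[P]_(x in A) e^\+ x \is a fin_num.
  apply: bound => // x /ck; rewrite ler_norml => /andP[k1 k2].
  rewrite funeposE /e/= -EFin_max lee_fin /Num.max; case: ifPn => //; lra.
have fen : \int[P]_(x in A) e^\- x \is a fin_num.
  apply: bound => // x /ck; rewrite ler_norml => /andP[k1 k2].
  rewrite funenegE /e/= -EFin_max lee_fin /Num.max; case: ifPn => //; lra.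
have fUp : \int[P]_(x in A) U^\+ x \is a fin_num.
  by apply: integrable_fin_num => //; exact: integrable_funepos.
have fLp : \int[P]_(x in A) L^\+ x \is a fin_num.
  rewrite ge0_fin_numE ?integral_ge0//.
  apply: (@le_lt_trans _ _ (\int[P]_(x in A) (U^\+ x + e^\+ x))).
    apply: ge0_le_integral => //; first exact: emeasurable_funD.
    move=> x _; rewrite !funeposE /U /e /=; case: (L x) => [r| |].
    - rewrite -EFinB -!EFin_max -EFinD lee_fin.
      by rewrite /Num.max; do !case: ifPn; lra.
    - by rewrite maxye -EFin_max addye.
    - by rewrite !maxNye -EFin_max add0e lee_fin le_max lexx orbT.
  rewrite ge0_integralD// ltey_eq fin_numD.
  by rewrite fUp fep.
have mYpA : measurable_fun A Yp.
  by apply: measurable_funTS; exact: measurable_wrtW mYp.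
have mYnA : measurable_fun A Yn.
  by apply: measurable_funTS; exact: measurable_wrtW mYn.
have leY : \int[P]_(x in A) (e^\+ x + L^\- x) <=
    \int[P]_(x in A) (L^\+ x + e^\- x).
  rewrite !ge0_integralD//.
  rewrite -YpE// -YnE// -!ge0_integralD//.
  apply: ae_ge0_le_integral => //.
  - by move=> x _; rewrite adde_ge0.
  - exact: emeasurable_funD.
  - by move=> x _; rewrite adde_ge0.
  - exact: emeasurable_funD.
  apply: filterS2 cY YE => x cYx [finY YEx] _; move: cYx; rewrite {}YEx.
  rewrite funeposE funenegE /e /= -!EFin_max.
  move: finY (Yp0 x) (Yn0 x); case: (Yp x) => [p| |]; case: (Yn x) => [n| |] //.
  - rewrite -EFinB -!EFinD !lee_fin => _ _ _ cx.
    by move: cx; rewrite /Num.max; do !case: ifPn; lra.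
  - by move=> _ _ _ _; rewrite addye// leey.
have eqI : \int[P]_(x in A) U^\+ x + \int[P]_(x in A) (e^\+ x + L^\- x) =
    \int[P]_(x in A) U^\- x + \int[P]_(x in A) (L^\+ x + e^\- x).
  rewrite -!ge0_integralD//; first last.
  all: try by move=> x _; rewrite adde_ge0.
  all: try exact: emeasurable_funD.
  by apply: eq_integral => x _; exact: funeposneg_subr.
rewrite -(@leeD2rE _ (\int[P]_(x in A) (L^\+ x + e^\- x))); last first.
  by rewrite ge0_integralD// fin_numD fLp fen.
by rewrite -eqI leeD2l.
Qed.

Lemma integral_expeR_bennett_le (A : set T) (k : R) :
  G A -> (forall x, A x -> `|c x| <= k)%R ->
  \int[P]_(x in A) X x <= (1 + w * bennett_cgf 1 b s)%:E * P A.
Proof.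
move=> GA ck; have mA := sG GA.
have cgf0 : (0 <= bennett_cgf 1 b s)%R by exact: bennett_cgf_ge0.
have intU := integrableS measurableT mA (@subsetT _ A) integrable_of_var.
have fUp : \int[P]_(x in A) U^\+ x \is a fin_num.
  by apply: integrable_fin_num => //; exact: integrable_funepos.
have mUp : measurable_fun A U^\+.
  by apply: measurable_funTS; exact: measurable_funepos.
have mUn : measurable_fun A U^\-.
  by apply: measurable_funTS; exact: measurable_funeneg.
have mXA : measurable_fun A X by exact: measurable_funTS.
have mU2A : measurable_fun A (fun x => U x ^+ 2) by exact: measurable_funTS.
(* The bound of [expRN_le_bennett], with [- s U] split between the sides. After integration the term
   in [U^\-] is at most the one in [U^\+] by the drift, and the latter is finite and cancels. *)
have : \int[P]_(x in A) (X x + s%:E * U^\+ x) <=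
    \int[P]_(x in A)
      (cst 1 x + (s%:E * U^\- x + (bennett_cgf 1 b s)%:E * (U x ^+ 2))).
  apply: ae_ge0_le_integral => //.
  - by move=> x _; rewrite adde_ge0// mule_ge0.
  - by apply: emeasurable_funD => //; exact: measurable_funeM.
  - by move=> x _; rewrite !adde_ge0// mule_ge0.
  - apply: emeasurable_funD => //.
    by apply: emeasurable_funD; exact: measurable_funeM.
  have := integrable_ae measurableT integrable_of_var.
  apply: filterS2 low => x lowx /(_ I) finU _; move: finU lowx.
  rewrite funeposE funenegE /X; case: (U x) => [u| |]// _.
  rewrite lee_fin -EFin_expe -!EFinM -!EFin_max -!EFinM -!EFinN /= -!EFinD.
  rewrite lee_fin => bu.
  have := expRN_le_bennett s0 b0 bu.
  have -> : (Num.max u 0 = Num.max (- u) 0 + u)%R.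
    by rewrite /Num.max; do !case: ifPn; lra.
  by lra.
rewrite !ge0_integralD//; first last.
all: try by move=> x _; rewrite ?adde_ge0// mule_ge0.
all: try by [exact: measurable_funeM|
  apply: emeasurable_funD; exact: measurable_funeM].
rewrite !ge0_integralZl// integral_cst// mul1e => le.
rewrite -(@leeD2rE _ (s%:E * \int[P]_(x in A) U^\+ x)) ?fin_numM//.
apply: (le_trans le).
rewrite EFinD ge0_muleDl ?lee_fin ?(mulr_ge0 w0 cgf0)// mul1e -addeA leeD2l//.
rewrite addeC.
apply: leeD.
  rewrite (mulrC w) (EFinM _ w) -[leRHS]muleA.
  by rewrite lee_wpmul2l ?lee_fin// var_le.
by rewrite lee_wpmul2l ?lee_fin//; exact: drift_funeneg_le GA ck.
Qed.

(** The lower bound on [U] gives [X <= e^(s b)] a.s.; a version of the conditional expectation then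
    exists. *)
Lemma integrable_expeR_bennett : P.-integrable setT X.
Proof.
apply/integrableP; split => //.
apply: (@le_lt_trans _ _ (\int[P]_x cst (expR (s * b))%:E x)).
  apply: ae_ge0_le_integral => //; first exact: measurableT_comp.
    by move=> x _; rewrite lee_fin expR_ge0.
  apply: filterS low => x lowx _.
  rewrite gee0_abs// -[leRHS]/(expeR (s * b)%:E) lee_expeR.
  rewrite leeNl -EFinN -mulrN EFinM lee_wpmul2l ?lee_fin//.
rewrite integral_cst// ltey_eq fin_numM//; exact: fin_num_measure.
Qed.

Lemma bennett_cond_cgf : exists2 Z, cond_exp_ge0 P G X Z &
  {ae P, forall x, Z x <= (1 + w * bennett_cgf 1 b s)%:E}.
Proof.
have [Z XZ] := cond_exp_ge0_exists G_sigma sG integrable_expeR_bennett X_ge0.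
exists Z => //; apply: (cond_exp_ge0_le mc _ XZ).
  by rewrite addr_ge0// mulr_ge0// bennett_cgf_ge0.
exact: integral_expeR_bennett_le.
Qed.

End Bennett.

End CondExpTools.

(** * The exponential Markov bound for the wealth *)

Lemma measurable_wrt_sub (d : measure_display) (T : measurableType d)
    (G H : set (set T)) d' (U : measurableType d') (X : T -> U) :
  sigma_algebra setT G -> sigma_algebra setT H -> G `<=` H ->
  measurable_wrt G X -> measurable_wrt H X.
Proof.
move=> sG sH GH mX _ A mA; have := mX measurableT A mA.
by rewrite !measurable_g_measurableTypeE//; exact: GH.
Qed.

Section Wealth.
Context (d : measure_display) (T : measurableType d) (R : realType).
Variables (F : nat -> set (set T)) (P1 : probability T R).
Variables (E : nat -> T -> \bar R) (c : nat -> T -> R).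
Hypothesis hF : is_filtration F.
Hypothesis E_ge0 : forall n x, (0 < n)%N -> 0 <= E n x.
Hypothesis mE : forall n, (0 < n)%N -> measurable_wrt (F n) (E n).
Hypothesis mc : forall n, (0 < n)%N -> measurable_wrt (F n.-1) (c n).

Lemma measurable_filtration n d' (U : measurableType d') (X : T -> U) :
  measurable_wrt (F n) X -> measurable_fun setT X.
Proof.
apply: measurable_wrtW; first exact: filtration_sigma hF n.
exact: (@filtration_sub _ _ _ hF n).
Qed.

Lemma measurable_bet n : (0 < n)%N -> measurable_fun setT (E n).
Proof. by move=> n0; exact: measurable_filtration (mE n0). Qed.

Lemma measurable_centred n : (0 < n)%N -> measurable_wrt (F n) (centred E c n).
Proof.
move=> n0; apply: emeasurable_funB.
  by apply: (measurableT_comp (@measurable_lne R)); exact: mE.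
apply/measurable_EFinP; apply: measurable_wrt_sub (mc n0).
- exact: filtration_sigma hF _.
- exact: filtration_sigma hF _.
- by apply: (filtration_mono hF); exact: leq_pred.
Qed.

Lemma measurable_wealth k : measurable_fun setT (wealth E k).
Proof.
elim: k => [|k IH].
  rewrite (_ : wealth E 0 = cst 1)//.
  by apply/funext => x; rewrite /wealth big_nil.
rewrite (_ : wealth E k.+1 = wealth E k \* E k.+1).
  by apply: emeasurable_funM => //; exact: measurable_bet.
by apply/funext => x; rewrite /wealth big_nat_recr.
Qed.

Lemma tau_gtE t alpha : [set x | (t%:R : R)%:E < tau E alpha x] =
  \bigcap_(k in [set k | (0 < k <= t)%N])
    [set x | wealth E k x <= (alpha^-1)%:E].
Proof.
apply/seteqP; split => x /=.
  move=> ttau k /andP[k0 kt] /=; rewrite leNgt; apply/negP => Wk.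
  have : tau E alpha x <= (k%:R : R)%:E by apply: ereal_inf_lbound; exists k.
  by move/(lt_le_trans ttau); rewrite lte_fin ltr_nat ltnNge kt.
(* An infimum preserves only weak bounds, so the strict one comes from integrality: crossings after
   [t] happen at [t.+1] or later. *)
move=> Wx; apply: (@lt_le_trans _ _ (t.+1%:R : R)%:E).
  by rewrite lte_fin ltr_nat.
apply: le_ereal_inf_tmp => _ [k [k0 Wk] <-]; rewrite lee_fin ler_nat ltnNge.
apply/negP => kt; have := Wx k; rewrite /= k0 kt => /(_ isT).
by rewrite leNgt Wk.
Qed.

Lemma gamma_bar_le_gamma t alpha : (0 < t)%N ->
  gamma_bar P1 E t alpha <= gamma P1 E t alpha.
Proof.
move=> t0; have mW k : measurable [set x | wealth E k x <= (alpha^-1)%:E].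
  rewrite -[X in measurable X]setTI.
  by apply: emeasurable_fun_infty_c => //; exact: measurable_wealth.
rewrite /gamma_bar /gamma tau_gtE; apply: le_measure; rewrite ?inE//.
  by apply: bigcap_measurableType => k _; exact: mW.
by move=> x /(_ t) /=; rewrite t0 leqnn; exact.
Qed.

Section Chernoff.
Variables (s : R) (K : nat -> R).
Hypothesis s0 : (0 <= s)%R.
Hypothesis K0 : forall n, (0 <= K n)%R.
Hypothesis fin : forall n, (0 < n)%N ->
  {ae P1, forall x, centred E c n x \is a fin_num}.
Hypothesis cgf : forall n, (0 < n)%N -> exists2 Z,
  cond_exp_ge0 P1 (F n.-1) (fun x => expeR (- (s%:E * centred E c n x))) Z &
  {ae P1, forall x, Z x <= (K n)%:E}.

(** [fine] replaces infinite values by 0; by [fin] this changes the increment only on a null set. *)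
Let v n x : R := fine (centred E c n x).
Let S k x : R := (\sum_(1 <= n < k.+1) v n x)%R.

Let mv n : (0 < n)%N -> measurable_wrt (F n) (v n).
Proof.
move=> n0; apply: measurableT_comp; first exact: fine_measurable.
exact: measurable_centred.
Qed.

Let mS k : measurable_wrt (F k) (S k).
Proof.
elim: k => [|k IH].
  rewrite (_ : S 0 = cst 0%R); first exact: measurable_cst.
  by apply/funext => x; rewrite /S big_nil.
rewrite (_ : S k.+1 = S k \+ v k.+1)%R.
  apply: measurable_funD; last exact: mv.
  apply: measurable_wrt_sub IH.
  - exact: filtration_sigma hF _.
  - exact: filtration_sigma hF _.
  - exact: (filtration_mono hF (leqnSn k)).
by apply/funext => x; rewrite /S big_nat_recr.
Qed.

Lemma integral_expR_centred_le k :
  \int[P1]_x (expR (- (s * S k x)))%:E <= (\prod_(1 <= n < k.+1) K n)%:E.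
Proof.
elim: k => [|k IH].
  rewrite big_nil (_ : (fun _ => _) = cst 1).
    by rewrite integral_cst// mul1e probability_le1.
  by apply/funext => x; rewrite /S big_nil mulr0 oppr0 expR0.
have mM : measurable_wrt (F k) (fun x => (expR (- (s * S k x)))%:E).
  apply/measurable_EFinP; apply: measurableT_comp => //.
  by apply: measurableT_comp => //; apply: measurable_funM => //; exact: mS.
have mX : measurable_fun setT (fun x => expR (- (s * v k.+1 x))).
  apply: (@measurable_filtration k.+1).
  apply: measurableT_comp => //; apply: measurableT_comp => //.
  by apply: measurable_funM => //; exact: mv.
rewrite big_nat_recr//= mulrC EFinM.
apply: le_trans (lee_wpmul2l _ IH); last by rewrite lee_fin.
under eq_integral do rewrite /S big_nat_recr//= mulrDr opprD expRD EFinM.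
(* The factor of the first [k] rounds is measurable for [F k], the very sigma-algebra on which round
   [k.+1] is conditioned. *)
apply: (@ge0_le_integralM_sub _ _ _ (F k)) => //.
- exact: filtration_sigma.
- exact: (@filtration_sub _ _ _ hF k).
- move=> A FA; have [Z ZE ZK] := cgf (ltn0Sn k).
  have mA : measurable A by exact: (filtration_sub hF FA).
  have XK := cond_exp_ge0_le_integral (filtration_sigma hF k)
    (@filtration_sub _ _ _ hF k) ZE ZK (K0 _) FA.
  apply: le_trans XK.
  apply: ae_ge0_le_integral => //.
  + by apply/measurable_EFinP; exact: measurable_funTS.
  + by move=> x _; exact: expeR_ge0.
  + apply: measurable_funTS; apply: (measurableT_comp (@measurable_expeR R)).
    apply: (measurableT_comp (@oppe_measurable R setT)).
    apply: measurable_funeM.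
    exact: (measurable_filtration (measurable_centred _)).
  apply: filterS (fin (ltn0Sn k)) => x fx _.
  by rewrite /v -[in leRHS](fineK fx).
Qed.

Lemma wealth_centredE k x :
  (forall n, (0 < n)%N -> centred E c n x \is a fin_num) ->
  wealth E k x = (expR (S k x + \sum_(1 <= n < k.+1) c n x))%:E.
Proof.
move=> finx; rewrite /S -big_split/=; elim: k => [|k IH].
  by rewrite /wealth !big_nil expR0.
rewrite [in RHS]big_nat_recr//= expRD EFinM /wealth big_nat_recr//=.
rewrite -[X in X * _]/(wealth E k x) IH.
congr (_ * _).
rewrite /v -[RHS]/(expeR ((fine (centred E c k.+1 x))%:E + (c k.+1 x)%:E)).
rewrite fineK ?finx//.
rewrite /centred subeK// /log_bet lneK// in_itv/= leey andbT; exact: E_ge0.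
Qed.

(** On the event, [S t] plus the total drift is at most [ln alpha^-1], so [S t <= - D] a.s. there,
    and the indicator is dominated by [e^(- s D) e^(- s S t)]. [D] may have either sign. *)
Lemma gamma_le_chernoff t alpha C : (0 < alpha)%R ->
  {ae P1, forall x, (C <= \sum_(1 <= n < t.+1) c n x)%R} ->
  gamma P1 E t alpha <=
  (expR (- (s * (C - ln alpha^-1))))%:E * (\prod_(1 <= n < t.+1) K n)%:E.
Proof.
move=> alpha0 hC; set D := (C - ln alpha^-1)%R.
apply: le_trans (lee_wpmul2l _ (integral_expR_centred_le t)); last first.
  by rewrite lee_fin expR_ge0.
have mW : measurable [set x | wealth E t x <= (alpha^-1)%:E].
  rewrite -[X in measurable X]setTI.
  by apply: emeasurable_fun_infty_c => //; exact: measurable_wealth.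
have mexp : measurable_fun setT (fun x => (expR (- (s * S t x)))%:E).
  apply: (@measurable_filtration t).
  apply/measurable_EFinP; apply: measurableT_comp => //.
  by apply: measurableT_comp => //; apply: measurable_funM => //; exact: mS.
rewrite -ge0_integralZl//.
rewrite /gamma -[in leLHS](setIT [set x | _]) -integral_indic//.
apply: ae_ge0_le_integral => //.
- by apply/measurable_EFinP.
- exact: measurable_funeM.
have fin' : {ae P1, forall x, forall n, (0 < n)%N ->
    centred E c n x \is a fin_num}.
  apply: ae_foralln => -[|n]; first exact: aeW.
  by apply: filterS (fin (ltn0Sn n)).
apply: filterS2 hC fin' => x Cx finx _; rewrite indicE.
have [|_] := boolP (x \in _); last by rewrite -EFinM lee_fin mulr_ge0 ?expR_ge0.
rewrite inE /= (wealth_centredE _ finx) lee_fin => Wx.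
rewrite -EFinM lee_fin -expRD -[leLHS]expR0 ler_expR.
have : (S t x + \sum_(1 <= n < t.+1) c n x <= ln alpha^-1)%R.
  by rewrite -ler_expR lnK// posrE invr_gt0.
move=> le_ln; rewrite -opprD oppr_ge0 -mulrDr mulr_ge0_le0//.
by rewrite /D; lra.
Qed.

End Chernoff.

End Wealth.

(** Optimisation over the tilt takes place after a logarithm, where the bounds say that [- lne g] is
    an upper bound of the set whose supremum is the rate; an infinite rate is covered. *)
Lemma le_expeRN_rate (R : realType) (smax : \bar R) (Psi : R -> R) (x : R)
    (g : \bar R) :
  0 <= g ->
  (forall s, tilts smax s -> g <= (expR (- (s * x - Psi s)))%:E) ->
  g <= expeR (- rate_function smax (fun s => (Psi s)%:E) x).
Proof.
move=> g0 gle; have gK : expeR (lne g) = g by rewrite lneK// in_itv/= g0 leey.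
rewrite -{}[leLHS]gK lee_expeR leeNr; apply: ge_ereal_sup => _ [s ts <-].
rewrite leeNr -lee_expeR lneK ?in_itv/= ?g0 ?leey//.
exact: gle.
Qed.

Theorem corollary4p17 (d : measure_display) (T : measurableType d)
  (R : realType) (F : nat -> set (set T)) (P0 P1 : probability T R)
  (E : nat -> T -> \bar R) (c : nat -> T -> R) (t : nat) (alpha C : R)
  (b_ w_ : nat -> R) (w b : R)
  (hF : is_filtration F)
  (hdom : loc_dominated F P1 P0)
  (hE : betting_sequence F P0 E)
  (hc : drift_certificate F P1 E c)
  (ht : (0 < t)%N)
  (halpha0 : (0 < alpha)%R) (halpha1 : (alpha < 1)%R)
  (hC : {ae P1, forall x, (C <= \sum_(1 <= n < t.+1) c n x)%R})
  (hb_ : forall n, (0 < n)%N -> (0 < b_ n)%R)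
  (hw_ : forall n, (0 < n)%N -> (0 <= w_ n)%R)
  (hlow : forall n, (0 < n)%N ->
     {ae P1, forall x, (expR (c n x - b_ n))%:E <= E n x})
  (hvar : forall n, (0 < n)%N ->
     exists2 Y, cond_exp_ge0 P1 (F n.-1) (fun x => centred E c n x ^+ 2) Y &
                {ae P1, forall x, Y x <= (w_ n)%:E})
  (hw : (\sum_(1 <= n < t.+1) w_ n <= w)%R)
  (hb : forall n, (0 < n <= t)%N -> (b_ n <= b)%R) :
  let psi := fun n s (_ : T) => (bennett_cgf (w_ n) (b_ n) s)%:E in
  let Psi := fun s : R => (bennett_cgf w b s)%:E in
  let Delta := excess_drift C alpha in
  [/\ is_majorant F P1 E c +oo psi,
      is_aggregate P1 c +oo psi t C Psi,
      forall x : R, (0 <= x)%R ->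
        rate_function +oo Psi x = bennett_rate w b x /\
        (bernstein_rate w b x)%:E <= bennett_rate w b x,
      (0 < w)%R ->
        is_optimal_tilt +oo Psi Delta (b^-1 * ln (1 + b * Delta / w))%R &
      [/\ gamma_bar P1 E t alpha <= gamma P1 E t alpha,
          gamma P1 E t alpha <= expeR (- bennett_rate w b Delta) &
          expeR (- bennett_rate w b Delta)
            <= (expR (- bernstein_rate w b Delta))%:E]].
Proof.
move=> psi Psi Delta.
have b0 : (0 < b)%R.
  by apply: lt_le_trans (hb_ _ ht) (hb _ _); rewrite ht leqnn.
have w0 : (0 <= w)%R.
  by apply: le_trans hw; rewrite big_nat sumr_ge0// => n /andP[/hw_].
have D0 : (0 <= Delta)%R by rewrite /Delta /excess_drift le_max lexx orbT.
have E0 n x : (0 < n)%N -> 0 <= E n x by move=> /hE[].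
have mE n : (0 < n)%N -> measurable_wrt (F n) (E n) by move=> /hE[].
have mc n : (0 < n)%N -> measurable_wrt (F n.-1) (c n) by move=> /hc[].
have mL n : (0 < n)%N -> measurable_fun setT (log_bet E n).
  move=> n0; apply: (measurableT_comp (@measurable_lne R)).
  exact: (measurable_bet hF mE n0).
have low n : (0 < n)%N -> {ae P1, forall x, (- b_ n)%:E <= centred E c n x}.
  move=> n0; apply: filterS (hlow n n0) => x.
  rewrite -[X in X <= _ -> _]/(expeR (c n x - b_ n)%:E) => le.
  rewrite /centred leeBrDr// -EFinD addrC /log_bet -lee_expeR lneK//.
  by rewrite in_itv/= leey andbT E0.
have fin n : (0 < n)%N -> {ae P1, forall x, centred E c n x \is a fin_num}.
  move=> n0.
  have := integrable_of_var (filtration_sigma hF n.-1)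
    (@filtration_sub _ _ _ hF n.-1) (mL n n0) (mc n n0) (hw_ n n0) (hvar n n0).
  move/(integrable_ae measurableT); apply: filterS => x; exact.
have cgf n s : (0 < n)%N -> (0 <= s)%R -> exists2 Z,
    cond_exp_ge0 P1 (F n.-1) (fun x => expeR (- (s%:E * centred E c n x))) Z &
    {ae P1, forall x, Z x <= (expR (bennett_cgf (w_ n) (b_ n) s))%:E}.
  move=> n0 s0.
  have [Z ZE Zle] := bennett_cond_cgf (filtration_sigma hF n.-1)
    (@filtration_sub _ _ _ hF n.-1) (mL n n0) (mc n n0) (hb_ n n0) (hw_ n n0) s0
    (hc n n0).2 (low n n0) (hvar n n0).
  exists Z => //; apply: filterS Zle => x /le_trans; apply.
  (* [1 + y <= e^y] turns the moment bound into a bound on its logarithm. *)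
  rewrite lee_fin (_ : w_ n * _ = bennett_cgf (w_ n) (b_ n) s)%R ?expR_ge1Dx//.
  by rewrite /bennett_cgf mul1r !mulrA.
have sum_le s : (0 <= s)%R ->
    (\sum_(1 <= n < t.+1) bennett_cgf (w_ n) (b_ n) s <= bennett_cgf w b s)%R.
  (* Once all rounds share the range [b], the cgf is linear in the variance parameter and the sum
     acts on [w_ n] alone. *)
  move=> s0; apply: (@le_trans _ _
    (\sum_(1 <= n < t.+1) bennett_cgf (w_ n) b s)%R).
    rewrite big_nat [leRHS]big_nat; apply: ler_sum => n nt.
    by case/andP: (nt) => n0 _; apply: bennett_cgf_le => //;
      [exact: hb_|exact: hb|exact: hw_].
  rewrite /bennett_cgf -!mulr_suml ler_wpM2r ?expR_rem2_ge0//.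
  by rewrite ler_wpM2r// invr_ge0 sqr_ge0.
split.
- split.
  + by move=> n s x n0 _; rewrite lee_fin bennett_cgf_ge0// hw_.
  + by move=> n s n0 _; exact: measurable_cst.
  + by move=> n x n0; rewrite /psi bennett_cgf_tilt0.
  + move=> n s n0 [s0 _]; have [Z ZE Zle] := cgf n s n0 s0.
    exists (fun x => lne (Z x)); first by exists Z.
    have [Z0 _ _] := ZE; apply: filterS Zle => x Zx.
    by rewrite -lee_expeR lneK// in_itv/= Z0 leey.
- split=> // s [s0 _]; apply: aeW => x.
  by rewrite /psi sumEFin lee_fin sum_le.
- move=> x x0; split; first exact: rate_function_bennett.
  exact: bernstein_le_bennett.
- move=> wp; split.
    by split; [exact: opt_tilt_ge0|rewrite ltry].
  rewrite rate_function_bennett// /bennett_rate gt_eqF//.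
  by rewrite -EFinB tilt_bennett_cgf_opt.
- split.
  + exact: (gamma_bar_le_gamma P1 hF mE).
  + rewrite -rate_function_bennett//; apply: le_expeRN_rate => // s [s0 _].
    have mW : measurable [set x | wealth E t x <= (alpha^-1)%:E].
      rewrite -[X in measurable X]setTI.
      by apply: emeasurable_fun_infty_c => //; exact: (measurable_wealth hF mE).
    have cgf0 := bennett_cgf_ge0 b s w0.
    (* Where the positive part truncates, [Delta] is 0 and the bound is [e^(Psi s) >= 1], which any
       probability satisfies. *)
    have [D1|D1] := leP (C - ln alpha^-1)%R 0%R.
      rewrite /Delta /excess_drift (max_idPr D1) mulr0 sub0r opprK.
      apply: (@le_trans _ _ 1); first exact: probability_le1.
      by rewrite lee_fin -[leLHS]expR0 ler_expR.
    have le := gamma_le_chernoff hF E0 mE mc s0 (fun n => expR_ge0 _) fin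
      (fun n n0 => cgf n s n0 s0) halpha0 hC.
    apply: (le_trans le).
    rewrite /Delta /excess_drift (max_idPl (ltW D1)) -EFinM lee_fin.
    rewrite -expR_sum -expRD.
    by rewrite ler_expR opprB addrC lerD2r sum_le.
  + rewrite -[leRHS]/(expeR (- (bernstein_rate w b Delta)%:E)) lee_expeR leeN2.
    exact: bernstein_le_bennett.
Qed.
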